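(* Let $A=\begin{pmatrix} a & b \\ c & 0 \end{pmatrix}\in M_2(\mathbb{Z})$ with $bc\neq 0$ and $\gcd(a,b,c)=1$, let $K=\mathbb{Q}(\sqrt{a^2+4bc})$ with ring of integers $\mathcal{O}_K$, let $u,v,w$ be nonzero integers with $\gcd(u,v,w)=1$, and let $n$ be a positive integer. Then there exist $X,Y,Z\in C(A)$ with $\det(XYZ)\neq 0$ and $uX^n+vY^n=wZ^n$ if and only if there exist $x,y,z\in\mathcal{O}_K$ with $xyz\neq 0$ and $ux^n+vy^n=wz^n$.
   Context: $C(A)=\{B\in M_2(\mathbb{Z}): AB=BA\}$. If $a^2+4bc$ is a square, $K=\mathbb{Q}$ and $\mathcal{O}_K=\mathbb{Z}$. *)

(* Defs.v *)
From HB Require Import structures.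
From mathcomp Require Import all_boot all_order all_algebra all_field.
Set Implicit Arguments.
Unset Strict Implicit.
Unset Printing Implicit Defensive.
Import Order.TTheory GRing.Theory Num.Theory.
Local Open Scope ring_scope.

Definition mx2 (R : Type) (a b c d : R) : 'M[R]_2 :=
  \matrix_(i < 2, j < 2)
    if i == 0 then (if j == 0 then a else b) else (if j == 0 then c else d).

Definition centralizer (A : 'M[int]_2) (B : 'M[int]_2) : Prop :=
  A *m B = B *m A.

(* Q(s) as the smallest subfield of algC containing s; every subfield of algC  *)
(* contains Q. A divringClosed predicate is boolean, but so is Q(s) itself     *)
(* (membership in the finite-dimensional Q-span of the powers of s is          *)
(* decidable by Crat_span), so the intersection is Q(s).                       *)
Definition Qadjoin (s x : algC) : Prop :=
  forall S : divringClosed algC, s \in S -> x \in S.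

Definition quadratic_field (D : int) : algC -> Prop :=
  Qadjoin (sqrtC D%:~R).

Definition ring_of_integers (K : algC -> Prop) (x : algC) : Prop :=
  K x /\ x \in Aint.

(* Main.v *)
Require Import Defs.
From HB Require Import structures.
From mathcomp Require Import all_boot all_order all_algebra all_field.
From mathcomp Require Import ring.
Set Implicit Arguments.
Unset Strict Implicit.
Unset Printing Implicit Defensive.
Import Order.TTheory GRing.Theory Num.Theory.
Local Open Scope ring_scope.

(* Since gcd(a, b, c) = 1, C(A) = Z[A]. Let l = (a + sqrt D) / 2 with          *)
(* D = a^2 + 4bc; both A and l are roots of X^2 - aX - bc, so evaluating at A  *)
(* and at l gives ring morphisms from Z[X] / (X^2 - aX - bc) onto C(A) and     *)
(* Z[l], and \det (p + qA) = (p + ql)(p + ql') where l' = a - l. Solutions in  *)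
(* C(A) are thus sent to solutions in Z[l]. Conversely the equation is         *)
(* homogeneous, so a solution in K may be scaled by an integer into Z[l], or   *)
(* into Z when l is rational; it then lifts to C(A).                           *)

(** An integer pair (p, q) stands for p + qx, with x either [A] or [l]. By [fermat_quad] the
    difference of the two sides of the equation is P + Qx with the same P and Q for both, so the
    equation holds at both as soon as P = Q = 0. At [A] this follows because b is nonzero; at [l] it
    is [quad_eq0]. When D is a square, 1 and [l] are dependent over Q, and the converse then takes
    pairs with q = 0, that is, scalar matrices. [centralizerP] supplies the pairs for C(A),
    [quadratic_field_denom] those for K, and [det_quad_norm] and [det_quad_neq0] carry nonvanishing
    across. *)

Section QuadraticPowers.

Variables (a N : int).

(** Coordinates of (s + tX)^n in the basis 1, X of Z[X] / (X^2 - aX - N), kept as integers so that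
    they can be read in any ring. *)
Fixpoint quad_pow (s t : int) (n : nat) : int * int :=
  if n is m.+1 then
    let: (p, q) := quad_pow s t m in
    (s * p + t * q * N, s * q + t * p + t * q * a)
  else (1, 0).

Lemma quad_powE (R : pzRingType) (x : R) (s t : int) (n : nat) :
  x * x = a%:~R * x + N%:~R ->
  (s%:~R + t%:~R * x) ^+ n
    = (quad_pow s t n).1%:~R + (quad_pow s t n).2%:~R * x.
Proof.
move=> xx; elim: n => [|n IHn]; first by rewrite expr0 /= mul0r addr0.
rewrite exprS IHn /=; case: (quad_pow s t n) => p q /=.
(* [R] must cover matrices, so it is not commutative; it is enough that integers are central. *)
have cx z : x * z%:~R = z%:~R * x by rewrite mulrzl mulrzr.
have -> : (s%:~R + t%:~R * x) * (p%:~R + q%:~R * x)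
  = s%:~R * p%:~R + s%:~R * q%:~R * x + (t%:~R * p%:~R * x
    + (t%:~R * q%:~R * a%:~R * x + t%:~R * q%:~R * N%:~R)).
  rewrite mulrDl !mulrDr !mulrA -(mulrA _ x p%:~R) cx -(mulrA _ x q%:~R) cx.
  by rewrite !mulrA -(mulrA _ x x) xx mulrDr !mulrA.
rewrite -!intrM !intrD !mulrDl -!addrA; congr (_ + _).
by rewrite [RHS]addrC -!addrA.
Qed.

(** Powers of integers stay integers; this serves the case where [l] is rational. *)
Lemma quad_pow0 (s : int) (n : nat) : (quad_pow s 0 n).2 = 0.
Proof.
elim: n => //= n; case: (quad_pow s 0 n) => p q /= ->.
by rewrite mulr0 !mul0r !addr0.
Qed.

End QuadraticPowers.

(** * Two-by-two matrices by entries *)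

Lemma mx2P (R : Type) (X : 'M[R]_2) : X = mx2 (X 0 0) (X 0 1) (X 1 0) (X 1 1).
Proof.
by apply/matrixP=> i j; rewrite mxE; case: i => [[|[|?]] ?] //;
  case: j => [[|[|?]] ?] //=; congr (X _ _); apply: val_inj.
Qed.

Lemma mx2_inj (R : Type) (p q r s p' q' r' s' : R) :
  mx2 p q r s = mx2 p' q' r' s' -> [/\ p = p', q = q', r = r' & s = s'].
Proof.
move=> /matrixP e; move: (e 0 0) (e 0 1) (e 1 0) (e 1 1).
by rewrite !mxE.
Qed.

Lemma mx2D (R : nmodType) (p q r s p' q' r' s' : R) :
  mx2 p q r s + mx2 p' q' r' s' = mx2 (p + p') (q + q') (r + r') (s + s').
Proof.
by apply/matrixP=> i j; rewrite !mxE; do 2!case: ifP.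
Qed.

Lemma mx2M (R : pzSemiRingType) (p q r s p' q' r' s' : R) :
  mx2 p q r s *m mx2 p' q' r' s'
    = mx2 (p * p' + q * r') (p * q' + q * s') (r * p' + s * r') (r * q' + s * s').
Proof.
apply/matrixP=> i j; rewrite !mxE !big_ord_recl big_ord0 !mxE addr0 /=.
by do 2!case: ifP.
Qed.

Lemma det_mx2 (R : comPzRingType) (p q r s : R) :
  \det (mx2 p q r s) = p * s - q * r.
Proof.
rewrite (expand_det_row _ 0) !big_ord_recl big_ord0 /cofactor !det_mx11 !mxE /=.
by rewrite expr0 expr1 mul1r mulN1r mulrN addr0.
Qed.

(** * The centralizer of [A] as Z[A] *)

Section Centralizer.

Variables (a b c : int).
Let A := mx2 a b c 0.

Lemma scalar_mx2 (p : int) : p%:~R = mx2 p 0 0 p.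
Proof.
rewrite -scaler_int intz scalemx1; apply/matrixP=> i j; rewrite !mxE.
by case: i => [[|[|?]] ?] //; case: j => [[|[|?]] ?].
Qed.

Lemma mx2_quad (p q : int) : p%:~R + q%:~R * A = mx2 (p + q * a) (q * b) (q * c) p.
Proof.
by rewrite !scalar_mx2 -mulmxE mx2M mx2D; congr mx2; ring.
Qed.

Lemma mx2_root : A * A = a%:~R * A + (b * c)%:~R.
Proof.
by rewrite addrC mx2_quad -mulmxE mx2M; congr mx2; ring.
Qed.

Lemma det_quad (p q : int) :
  \det (p%:~R + q%:~R * A) = p ^+ 2 + a * p * q - b * c * q ^+ 2.
Proof. by rewrite mx2_quad det_mx2; ring. Qed.

Lemma centralizer_quad (p q : int) : centralizer A (p%:~R + q%:~R * A).
Proof. by rewrite /centralizer mx2_quad !mx2M; congr mx2; ring. Qed.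

(** Commuting with [A] makes (X00 - X11, X01, X10) proportional to (a, b, c); as this triple is
    primitive, the ratio is an integer, the coefficient of [A]. The constant coefficient is X11,
    since the corner entry of [A] is 0. *)
Lemma centralizerP (X : 'M[int]_2) :
  b * c != 0 -> gcdz (gcdz a b) c = 1 -> centralizer A X ->
  exists p q : int, X = p%:~R + q%:~R * A.
Proof.
rewrite mulf_eq0 negb_or => /andP[b0 c0] g1.
rewrite /centralizer (mx2P X).
move: (X 0 0) (X 0 1) (X 1 0) (X 1 1) => p q r s.
rewrite !mx2M => E; have [e1 _ e3 _] := mx2_inj E.
(* The Bezout relation i a + j b + k c = 1 inverts the map q |-> q (a, b, c). *)
have [i [j eg]] := Bezoutz a b; have [k [l el]] := Bezoutz (gcdz a b) c.
rewrite g1 -eg in el.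
exists s, (k * (i * (p - s) + j * q) + l * r); rewrite mx2_quad.
set t := _ + l * r.
have E1 : (p - s) * c = a * r.
  by move: e3; rewrite mul0r addr0 mulrBl [p * c]mulrC => ->; ring.
have E2 : q * c = b * r by apply: (addrI (p * a)); rewrite -e1 [a * p]mulrC.
have tc : t * c = r.
  have -> : t * c = k * (i * ((p - s) * c) + j * (q * c)) + l * r * c.
    by rewrite /t; ring.
  by rewrite E1 E2 -[RHS]mul1r -el; ring.
have qE : q = t * b by apply: (mulIf c0); rewrite mulrAC tc E2 mulrC.
have pE : p = s + t * a.
  by apply: (mulIf c0); rewrite mulrDl mulrAC tc [r * a]mulrC -E1; ring.
by rewrite -pE -qE tc.
Qed.

End Centralizer.

(** * The field Q(r) for r^2 rational *)

Lemma Crat_span1P (r x : algC) :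
  reflect (exists s t : rat, x = ratr s + ratr t * r) (x \in Crat_span [:: 1; r]).
Proof.
apply: (iffP (Crat_spanP _ _)) => [[f ->] | [s [t ->]]].
  exists (f ord0), (f (lift ord0 ord0)).
  by rewrite !big_ord_recl big_ord0 /= mulr1 addr0.
exists [ffun i => if i == ord0 then s else t].
by rewrite !big_ord_recl big_ord0 !ffunE /= mulr1 addr0.
Qed.

Lemma Crat_span_sqrt_closed (r : algC) :
  r ^+ 2 \in Crat -> r \notin Crat -> divring_closed (Crat_span [:: 1; r]).
Proof.
move=> /CratP[d rr] nr.
have inv x : x \in Crat_span [:: 1; r] -> x^-1 \in Crat_span [:: 1; r].
  move=> /Crat_span1P[s [t ->]]; apply/Crat_span1P.
  have [-> | x0] := eqVneq (ratr s + ratr t * r) 0.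
    by exists 0, 0; rewrite invr0 rmorph0 mul0r addr0.
  (* The inverse of s + tr is its conjugate divided by the norm [e]. The conjugate is nonzero, for
     otherwise either s = t = 0 or r = s / t is rational. *)
  have y0 : ratr s - ratr t * r != 0.
    apply: contraNneq x0 => /eqP; rewrite subr_eq0 => /eqP E.
    have [t0 | t0] := eqVneq t 0.
      by move: E; rewrite t0 rmorph0 mul0r => ->; rewrite addr0.
    case/negP: nr; apply/CratP; exists (s / t).
    by rewrite fmorph_div /= E mulrC mulKf // fmorph_eq0.
  pose e := s * s - t * t * d.
  have eE : ratr e = (ratr s - ratr t * r) * (ratr s + ratr t * r) :> algC.
    by rewrite rmorphB !rmorphM /= -rr; ring.
  have e0 : ratr e != 0 :> algC by rewrite eE mulf_neq0.
  exists (s / e), (- t / e); apply: (mulIf x0); rewrite mulVf // !fmorph_div rmorphN.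
  by rewrite -(mulfV e0) {1}eE /=; ring.
split=> [|x y|x y].
- by apply/Crat_span1P; exists 1, 0; rewrite rmorph1 rmorph0 mul0r addr0.
- exact: rpredB.
move=> /Crat_span1P[s [t ->]] /inv/Crat_span1P[s' [t' ->]].
apply/Crat_span1P; exists (s * s' + t * t' * d), (s * t' + t * s').
by rewrite !rmorphD !rmorphM /= -rr; ring.
Qed.

(** [Qadjoin] is tested on a single subfield: Q if r is rational, otherwise the span of 1 and r. The
    last clause fixes the choice of coefficients when 1 and r are dependent. *)
Lemma Qadjoin_sqrt (r x : algC) : r ^+ 2 \in Crat -> Qadjoin r x ->
  exists s t : rat, x = ratr s + ratr t * r /\ (r \in Crat -> t = 0).
Proof.
move=> rr Kx; have [rQ | rQ] := boolP (r \in Crat).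
  have /CratP[s ->] := Kx Crat rQ.
  by exists s, 0; rewrite rmorph0 mul0r addr0.
pose S : divringClosed algC := HB.pack (fun y => y \in Crat_span [:: 1; r])
  (GRing.isDivringClosed.Build algC (fun y => y \in Crat_span [:: 1; r])
     (Crat_span_sqrt_closed rr rQ)).
have rS : r \in S by apply: mem_Crat_span; rewrite !inE eqxx orbT.
by have /Crat_span1P[s [t ->]] := Kx S rS; exists s, t.
Qed.

Lemma Qadjoin_sqrt_denom (r x : algC) : r ^+ 2 \in Crat -> Qadjoin r x ->
  exists m p q : int, [/\ m != 0, m%:~R * x = p%:~R + q%:~R * r
                        & r \in Crat -> q = 0].
Proof.
move=> rr /(Qadjoin_sqrt rr)[s [t [-> t0]]].
exists (denq s * denq t), (numq s * denq t), (numq t * denq s); split.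
- by rewrite mulf_neq0 ?denq_neq0.
- have ds : (denq s)%:~R != 0 :> algC by rewrite intr_eq0 denq_neq0.
  have dt : (denq t)%:~R != 0 :> algC by rewrite intr_eq0 denq_neq0.
  by rewrite /ratr !intrM; field; rewrite ds dt.
- by move=> /t0 ->; rewrite mul0r.
Qed.

(** If q were nonzero, y = -p / q would be rational, and the hypothesis would force q = 0. *)
Lemma quad_eq0 (p q : int) (y : algC) : (y \in Crat -> q = 0) ->
  p%:~R + q%:~R * y = 0 -> p = 0 /\ q = 0.
Proof.
move=> yQ E; have q0 : q = 0.
  apply/eqP/negPn/negP => q0; case/eqP: (q0); apply: yQ.
  have -> : y = - p%:~R / q%:~R.
    have q0' : q%:~R != 0 :> algC by rewrite intr_eq0.
    apply: (mulfI q0'); rewrite mulrCA mulfV // mulr1.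
    by apply/eqP; rewrite -addr_eq0 addrC E.
  by rewrite rpred_div ?rpredN ?rpred_int.
by move: E; rewrite q0 mul0r addr0 => /eqP; rewrite intr_eq0 => /eqP.
Qed.

(** * The eigenvalue [l] of [A] *)

Section Eigenvalue.

Variables (a b c : int).
Let A := mx2 a b c 0.
Let r : algC := sqrtC (a ^+ 2 + 4 * b * c)%:~R.
Let l : algC := (a%:~R + r) / 2.

Let r_sqr : r ^+ 2 = a%:~R ^+ 2 + 4 * b%:~R * c%:~R.
Proof. by rewrite sqrtCK; ring. Qed.

Let r_sqr_Crat : r ^+ 2 \in Crat.
Proof. by rewrite sqrtCK rpred_int. Qed.

Let rE : r = l *+ 2 - a%:~R.
Proof. by rewrite /l; field. Qed.

Lemma eigen_root : l * l = a%:~R * l + (b * c)%:~R.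
Proof.
have -> : l * l = (a%:~R ^+ 2 + a%:~R * r *+ 2 + r ^+ 2) / 4 by rewrite /l; field.
by rewrite r_sqr intrM /l; field.
Qed.

Let l_Crat : (l \in Crat) = (r \in Crat).
Proof.
apply/idP/idP => [lQ | rQ]; first by rewrite rE rpredB ?rpredMn ?rpred_int.
by rewrite rpred_div ?rpredD ?rpred_int ?rpred_nat.
Qed.

Let l_Aint : l \in Aint.
Proof.
pose q : {poly algC} := a%:~R *: 'X + (b * c)%:~R%:P.
have sz : (size q < size ('X^2 : {poly algC}))%N.
  rewrite size_polyXn ltnS (leq_trans (size_polyD _ _)) // geq_max.
  rewrite (leq_trans (size_scale_leq _ _)) ?size_polyX //.
  exact: leq_trans (size_polyC_leq1 _) _.
apply: (@root_monic_Aint ('X^2 - q)).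
- rewrite /root hornerD hornerN hornerD hornerXn hornerZ hornerX hornerC.
  by rewrite expr2 eigen_root subrr.
- by rewrite monicE lead_coefDl ?size_polyN // lead_coefXn.
- apply/polyOverP=> i; rewrite coefB coefD coefZ coefX coefXn coefC -mulrb.
  by rewrite rpredB ?rpredD ?rpredM ?rpredMn ?rpred_int ?rpred1.
Qed.

Lemma quad_OK (p q : int) :
  ring_of_integers (quadratic_field (a ^+ 2 + 4 * b * c)) (p%:~R + q%:~R * l).
Proof.
split=> [S rS|]; last first.
  apply: rpredD; first exact: Aint_int.
  by apply: rpredM; [exact: Aint_int | exact: l_Aint].
have lS : l \in S.
  apply: rpred_div; last exact: rpred_nat.
  by apply: rpredD; [exact: rpred_int | exact: rS].
apply: rpredD; first exact: rpred_int.
by apply: rpredM; [exact: rpred_int | exact: lS].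
Qed.

Lemma det_quad_norm (p q : int) :
  (\det (p%:~R + q%:~R * A))%:~R
    = (p%:~R + q%:~R * l) * (p%:~R + q%:~R * (a%:~R - l)) :> algC.
Proof.
have -> : (p%:~R + q%:~R * l) * (p%:~R + q%:~R * (a%:~R - l))
    = p%:~R ^+ 2 + a%:~R * p%:~R * q%:~R + q%:~R ^+ 2 * (a%:~R * l - l * l) by ring.
by rewrite eigen_root det_quad; ring.
Qed.

(** The determinant also contains the conjugate factor p + q(a - l). For irrational [l] it vanishes
    only if p = q = 0; for rational [l] it could vanish alone, which the condition q = 0
    excludes. *)
Lemma det_quad_neq0 (p q : int) : (l \in Crat -> q = 0) ->
  p%:~R + q%:~R * l != 0 -> \det (p%:~R + q%:~R * A) != 0.
Proof.
move=> lQ x0; rewrite -(intr_eq0 algC) det_quad_norm mulf_neq0 //.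
apply: contraNneq x0 => /quad_eq0[| -> ->]; last by rewrite mul0r addr0.
by move=> yQ; apply: lQ; rewrite -(subKr a%:~R l) rpredB ?rpred_int.
Qed.

Lemma quadratic_field_denom (x : algC) :
  quadratic_field (a ^+ 2 + 4 * b * c) x ->
  exists m p q : int, [/\ m != 0, m%:~R * x = p%:~R + q%:~R * l
                        & l \in Crat -> q = 0].
Proof.
move=> /(Qadjoin_sqrt_denom r_sqr_Crat)[m [p [q [m0 E q0]]]].
(* Change of basis by r = 2l - a. *)
exists m, (p - q * a), (q * 2); split=> //.
  by rewrite E -/r rE intrB !intrM; ring.
by rewrite l_Crat => /q0 ->; rewrite mul0r.
Qed.

Variables (u v w : int) (n : nat).

(* The left-hand sides of the two equations are the values at [A] and at [l]  *)
(* of one and the same linear polynomial.                                      *)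
Lemma fermat_quad (x1 x2 y1 y2 z1 z2 : int) :
  exists P Q : int,
  [/\ x2 = 0 -> y2 = 0 -> z2 = 0 -> Q = 0
    & forall (R : pzRingType) (x : R), x * x = a%:~R * x + (b * c)%:~R ->
      u%:~R * (x1%:~R + x2%:~R * x) ^+ n + v%:~R * (y1%:~R + y2%:~R * x) ^+ n
      - w%:~R * (z1%:~R + z2%:~R * x) ^+ n = P%:~R + Q%:~R * x].
Proof.
pose f s t := quad_pow a (b * c) s t n.
exists (u * (f x1 x2).1 + v * (f y1 y2).1 - w * (f z1 z2).1).
exists (u * (f x1 x2).2 + v * (f y1 y2).2 - w * (f z1 z2).2).
split=> [-> -> -> | R x xx]; first by rewrite /f !quad_pow0 !mulr0 subr0 addr0.
rewrite !(quad_powE _ _ _ xx) -/(f x1 x2) -/(f y1 y2) -/(f z1 z2).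
rewrite !intrB !intrD !intrM !mulrDr !mulrDl !mulrA mulNr opprD.
by rewrite [X in X + (_ - _) = _]addrACA [LHS]addrACA.
Qed.

End Eigenvalue.

(** * Transfer of solutions between C(A) and the ring of integers *)

Theorem theorem3p4 (a b c u v w : int) (n : nat)
  (hbc : b * c != 0)
  (habc : gcdz (gcdz a b) c = 1)
  (hu : u != 0) (hv : v != 0) (hw : w != 0)
  (huvw : gcdz (gcdz u v) w = 1)
  (hn : (0 < n)%N) :
  let A := mx2 a b c 0 in
  let OK := ring_of_integers (quadratic_field (a ^+ 2 + 4 * b * c)) in
  (exists X Y Z : 'M[int]_2,
     [/\ centralizer A X, centralizer A Y, centralizer A Z,
         \det (X *m Y *m Z) != 0
       & u *: X ^+ n + v *: Y ^+ n = w *: Z ^+ n]) <->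
  (exists x y z : algC,
     [/\ OK x, OK y, OK z,
         x * y * z != 0
       & u%:~R * x ^+ n + v%:~R * y ^+ n = w%:~R * z ^+ n]).
Proof.
move=> A OK.
pose l : algC := (a%:~R + sqrtC (a ^+ 2 + 4 * b * c)%:~R) / 2.
have AA := mx2_root a b c; have ll := eigen_root a b c.
have scale_int k (M : 'M[int]_2) : k *: M = k%:~R * M.
  by rewrite mulrzl -scaler_int intz.
split=> [[X [Y [Z [CX CY CZ]]]] | [x [y [z [[Kx _] [Ky _] [Kz _]]]]]].
  have [x1 [x2 ->]] := centralizerP hbc habc CX.
  have [y1 [y2 ->]] := centralizerP hbc habc CY.
  have [z1 [z2 ->]] := centralizerP hbc habc CZ.
  rewrite !det_mulmx !mulf_eq0 !negb_or !scale_int => /andP[/andP[dX dY] dZ] E.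
  have [P [Q [_ PQ]]] := fermat_quad a b c u v w n x1 x2 y1 y2 z1 z2.
  have nz p q : \det (p%:~R + q%:~R * mx2 a b c 0) != 0 -> p%:~R + q%:~R * l != 0.
    rewrite -(intr_eq0 algC) det_quad_norm mulf_eq0 negb_or.
    by case/andP.
  exists (x1%:~R + x2%:~R * l), (y1%:~R + y2%:~R * l), (z1%:~R + z2%:~R * l).
  split; try exact: quad_OK.
    by rewrite !mulf_neq0 ?nz.
  (* The matrix P + QA is zero; its upper-right entry is Qb with b nonzero, and its lower-right
     entry is P. *)
  have := PQ _ _ AA; rewrite E subrr mx2_quad => /esym /matrixP M0.
  have Q0 : Q = 0.
    have := M0 0 1; rewrite !mxE /= => /eqP; rewrite mulf_eq0.
    by move: hbc; rewrite mulf_eq0 negb_or => /andP[/negPf-> _];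
      rewrite orbF => /eqP.
  have P0 : P = 0 by have := M0 1 1; rewrite !mxE.
  apply/eqP; rewrite -subr_eq0; apply/eqP.
  by rewrite (PQ _ _ ll) P0 Q0 mul0r addr0.
rewrite !mulf_eq0 !negb_or => /andP[/andP[x0 y0] z0] E.
have [m [p1 [p2 [m0 Ex p20]]]] := quadratic_field_denom Kx.
have [k [q1 [q2 [k0 Ey q20]]]] := quadratic_field_denom Ky.
have [h [r1 [r2 [h0 Ez r20]]]] := quadratic_field_denom Kz.
rewrite -/l in Ex Ey Ez p20 q20 r20.
(* All three unknowns are scaled by the same integer mkh, so the equation is multiplied by
   (mkh)^n. *)
have Ex' : (k * h * p1)%:~R + (k * h * p2)%:~R * l = (m * k * h)%:~R * x.
  by rewrite [RHS](_ : _ = k%:~R * h%:~R * (m%:~R * x)); [rewrite Ex|]; ring.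
have Ey' : (m * h * q1)%:~R + (m * h * q2)%:~R * l = (m * k * h)%:~R * y.
  by rewrite [RHS](_ : _ = m%:~R * h%:~R * (k%:~R * y)); [rewrite Ey|]; ring.
have Ez' : (m * k * r1)%:~R + (m * k * r2)%:~R * l = (m * k * h)%:~R * z.
  by rewrite [RHS](_ : _ = m%:~R * k%:~R * (h%:~R * z)); [rewrite Ez|]; ring.
have [P [Q [Q0 PQ]]] := fermat_quad a b c u v w n
  (k * h * p1) (k * h * p2) (m * h * q1) (m * h * q2) (m * k * r1) (m * k * r2).
have M0 : (m * k * h)%:~R != 0 :> algC by rewrite intr_eq0 !mulf_neq0.
have PQl : P%:~R + Q%:~R * l = 0.
  rewrite -(PQ _ _ ll) Ex' Ey' Ez' !exprMn !(mulrCA _ ((m * k * h)%:~R ^+ n)).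
  by rewrite -mulrDr E subrr.
(* For rational [l] all the coefficients of [l] were chosen zero, hence Q = 0. *)
have [|P0 Q00] := quad_eq0 _ PQl.
  by move=> lQ; apply: Q0; rewrite ?p20 ?q20 ?r20 ?mulr0.
exists ((k * h * p1)%:~R + (k * h * p2)%:~R * A).
exists ((m * h * q1)%:~R + (m * h * q2)%:~R * A).
exists ((m * k * r1)%:~R + (m * k * r2)%:~R * A).
split; try exact: centralizer_quad.
  rewrite !det_mulmx !mulf_neq0 ?det_quad_neq0 -/l ?Ex' ?Ey' ?Ez' ?mulf_neq0 //.
  - by move=> /p20 ->; rewrite mulr0.
  - by move=> /q20 ->; rewrite mulr0.
  - by move=> /r20 ->; rewrite mulr0.
apply/eqP; rewrite -subr_eq0 !scale_int; apply/eqP.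
by rewrite (PQ _ _ AA) P0 Q00 mul0r addr0.
Qed.
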